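(* Fix $\beta\in(0,1)$ and let $p=p(N)\in(0,1]$. Let $g:\mathbb R\to\mathbb R$ be a non-negative bounded continuous function with $g\not\equiv0$, and let $\xi$ be a standard normally distributed random variable, with $\mathbb E_\xi$ denoting expectation with respect to $\xi$. Then, as $N\to\infty$: (a) If $pN\to\infty$, then $$\mathbb E Z_N(\beta,g)\sim\exp\left(-\frac{\beta^2}{8}+N^2p\left(\cosh\left(\frac{\beta}{2Np}\right)-1\right)\right)2^N\,\mathbb E_\xi\left[g(\xi)e^{\frac\beta2\xi^2}\right].$$ (b) If $p^3N^2\to\infty$, then $$\mathbb E Z_N(\beta,g)\sim e^{\frac{(1-p)\beta^2}{8p}}\,2^N\,\mathbb E_\xi\left[g(\xi)e^{\frac\beta2\xi^2}\right].$$ (c) If $g\equiv1$ and $p^3N^2\to\infty$, then for the partition function $Z_N(\beta)=Z_N(\beta,1)$ we have $$\mathbb E Z_N(\beta)\sim e^{\frac{(1-p)\beta^2}{8p}}\,\frac{2^N}{\sqrt{1-\beta}}.$$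
   Context: For each $N\in\mathbb N$ let $p=p(N)\in(0,1]$ and let $(\varepsilon_{i,j})_{i,j=1}^N$ be independent random variables on a probability space with probability measure $\mathbb P$, with $\mathbb P[\varepsilon_{i,j}=1]=p$ and $\mathbb P[\varepsilon_{i,j}=0]=1-p$ (indicators of the directed edges, loops allowed, of a directed Erdős–Rényi random graph on $\{1,\dots,N\}$). $\mathbb E$ denotes expectation with respect to $\mathbb P$, i.e. with respect to the randomness of $(\varepsilon_{i,j})$. The Hamiltonian is, for $\sigma\in\{-1,+1\}^N$, $$H(\sigma)=H_N(\sigma)=-\frac1{2Np}\sum_{i,j=1}^N\varepsilon_{i,j}\sigma_i\sigma_j.$$ For a bounded continuous function $g:\mathbb R\to\mathbb R$ the generalized partition function is $$Z_N(\beta,g)=\sum_{\sigma\in\{-1,+1\}^N}e^{-\beta H(\sigma)}\,g\left(\frac{\sum_{i=1}^N\sigma_i}{\sqrt N}\right).$$ For two sequences $(a_N)$ and $(b_N)$, $a_N\sim b_N$ means that $a_N/b_N\to1$ as $N\to\infty$. *)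

(* Defs.v *)
From mathcomp Require Import all_boot all_order all_algebra.
From mathcomp Require Import all_classical all_reals all_analysis.
Set Implicit Arguments.
Unset Strict Implicit.
Unset Printing Implicit Defensive.
Import Order.TTheory GRing.Theory Num.Theory.
Import numFieldNormedType.Exports.
Local Open Scope classical_set_scope.
Local Open Scope ring_scope.

Definition cosh (R : realType) (x : R) : R := (expR x + expR (- x)) / 2.

(* Mutual independence of a finite family of random variables: the product
   rule over every subfamily [J]. *)
Definition mutually_independent (R : realType) (d d' : measure_display)
    (T : measurableType d) (T' : measurableType d') (P : probability T R)
    (I : finType) (X : I -> {RV P >-> T'}) : Prop :=
  forall (J : {set I}) (B : I -> set T'),
    (forall i, measurable (B i)) ->
    P (\bigcap_(i in [set` J]) (X i @^-1` B i))
    = (\prod_(i in J) P (X i @^-1` B i))%E.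

(* A configuration in {-1,+1}^N is encoded by booleans: [false] is the spin
   +1 and [true] is the spin -1. *)
Definition config (N : nat) := {ffun 'I_N -> bool}.

Definition spin (R : realType) (N : nat) (s : config N) (i : 'I_N) : R :=
  (-1) ^+ s i.

Definition hamiltonian (R : realType) (N : nat) (p : R)
    (e : 'I_N -> 'I_N -> R) (s : config N) : R :=
  - (1 / (2 * N%:R * p)) *
    \sum_(i < N) \sum_(j < N) e i j * spin R s i * spin R s j.

Definition partition_fun (R : realType) (N : nat) (p beta : R) (g : R -> R)
    (e : 'I_N -> 'I_N -> R) : R :=
  \sum_(s : config N)
    expR (- beta * hamiltonian p e s)
    * g ((\sum_(i < N) spin R s i) / Num.sqrt N%:R).

Definition asymp_equiv (R : realType) (a b : nat -> R) : Prop :=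
  a N / b N @[N --> \oo] --> (1 : R).

(* Main.v *)
Require Import Defs.
From mathcomp Require Import all_boot all_order all_algebra.
From mathcomp Require Import all_classical all_reals all_analysis.
From mathcomp Require Import measurable_realfun ring lra zify.
Import Order.TTheory GRing.Theory Num.Theory.
Import numFieldNormedType.Exports.
Local Open Scope classical_set_scope.
Local Open Scope ring_scope.

(** Averaging over the edges factorises: each pair (i,j) contributes
    w(s_i s_j) with w(t) = 1 - p + p exp(x t) and x = beta/(2Np).  Since s_i s_j
    is a sign, the product over all pairs equals exp(A_N + (c_N/2) S^2/N), where
    S is the total spin, A_N = N^2 (ln w(1) + ln w(-1))/2 and
    c_N = N (ln w(1) - ln w(-1)).  Taylor estimates give c_N -> beta and the
    asymptotics of A_N.

    What remains is the binomial mean of g(y) exp(c_N y^2/2) at y = S/sqrt N,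
    computed by a local limit theorem without Stirling's formula.  The weight
    v_N(m) = C(N,m) exp((2m-N)^2/(2(N+1))) satisfies
    v_N(m+1)/v_N(m) = (1-u)/(1+u) exp(2u) with u = (2m+1-N)/(N+1), and this
    ratio lies in [1 - 2u^2, 1] for u >= 0.  Hence v_N is maximal at the centre
    and is asymptotically constant where 2m - N = O(sqrt N).  The binomial sum
    is therefore v_N(centre) sqrt N/2 times the integral of a step function,
    which converges by dominated convergence (beta < 1 provides the Gaussian
    majorant).  The unknown constant cancels against the same statement for the
    function 1, where the sum is 2^N. *)

(** * Averaging over the edges *)

(** Almost surely every [X i] is 0 or 1, so the product is a finite combination of indicators of the
    patterns [D e]. Independence is thus needed only for events: it gives [P (D e)] as a product,
    and distributivity folds the sum over patterns back into a product of two-term sums. *)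
Lemma independent_binary_prod_expectation (R : realType) (d : measure_display)
    (T : measurableType d) (P : probability T R) (I : finType)
    (X : I -> {RV P >-> R}) (q : R) (h : I -> R -> R) :
  mutually_independent X ->
  (forall i, P [set w | X i w = 1] = q%:E) ->
  (forall i, P [set w | X i w = 0] = (1 - q)%:E) ->
  (forall i x, 0 <= h i x) ->
  (forall i, measurable_fun setT (h i)) ->
  (\int[P]_w (\prod_i h i (X i w))%:E)%E =
  (\prod_i ((1 - q) * h i 0 + q * h i 1))%:E.
Proof.
move=> Xindep X1 X0 h0 mh.
pose D (e : {ffun I -> bool}) : set T :=
  \bigcap_(i in [set` [set: I]%SET]) (X i @^-1` [set (e i)%:R]).
have mX i b : measurable (X i @^-1` [set b]).
  by rewrite -[X in measurable X]setTI; exact: measurable_funP.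
have mD e : measurable (D e) by apply: fin_bigcap_measurable.
have DE e w : D e w <-> forall i, X i w = (e i)%:R.
  by split=> [De i|H i _]; [apply: De; rewrite /= inE|exact: H].
have PD e : P (D e) = (\prod_i (if e i then q else 1 - q))%:E.
  rewrite Xindep// -prodEFin; apply: eq_big => [i|i _]; first by rewrite inE.
  by case: (e i); [exact: X1|exact: X0].
(* The two disjoint events have probabilities adding up to 1, so the complement of their union is
   null. *)
have bin i : {ae P, forall w, X i w = 0 \/ X i w = 1}.
  pose B := X i @^-1` [set 0] `|` X i @^-1` [set 1].
  exists (~` B); split.
  - by apply: measurableC; exact: measurableU.
  - rewrite probability_setC; last exact: measurableU.
    rewrite measureU//; last first.
      by rewrite -subset0 => w [/= -> /eqP]; rewrite eq_sym oner_eq0.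
    rewrite [X in (_ - (X + _))%E](_ : _ = (1 - q)%:E); last exact: X0.
    rewrite [X in (_ - (_ + X))%E](_ : _ = q%:E); last exact: X1.
    by rewrite -EFinD subrK subrr.
  - by apply: subsetC => w [] /= ?; [left|right].
pose H (e : {ffun I -> bool}) := \prod_i h i (e i)%:R.
transitivity (\int[P]_w (\sum_(e : {ffun I -> bool}) (H e * \1_(D e) w))%:E)%E.
  have H0 e : 0 <= H e by apply: prodr_ge0.
  apply: ge0_ae_eq_integral => //.
  - apply/measurable_EFinP; apply: measurable_prod => i _.
    exact: measurableT_comp.
  - apply/measurable_EFinP; apply: measurable_sum => e.
    by apply: measurable_funM => //; exact: measurable_indic.
  - by move=> w _; rewrite lee_fin; apply: prodr_ge0.
  - by move=> w _; rewrite lee_fin; apply: sumr_ge0 => e _; rewrite mulr_ge0.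
  - near=> w => _; congr EFin.
    have bw : forall i, X i w = 0 \/ X i w = 1.
      by near: w; exact: filter_forall.
    pose e0 : {ffun I -> bool} := [ffun i => X i w == 1].
    have e0E i : X i w = (e0 i)%:R.
      rewrite ffunE; case: (bw i) => ->; last by rewrite eqxx.
      by rewrite eq_sym oner_eq0.
    rewrite (bigD1 e0)//= [X in _ = _ + X]big1 ?addr0.
      rewrite indicE mem_set ?mulr1; last exact/DE.
      by rewrite /H; apply: eq_bigr => i _; rewrite -e0E.
    move=> e ee0; rewrite indicE memNset ?mulr0// => /DE De.
    move/eqP: ee0; apply; apply/ffunP => i; rewrite ffunE De.
    by case: (e i); rewrite ?eqxx// eq_sym oner_eq0.
under eq_integral do rewrite -sumEFin.
rewrite ge0_integral_sum//; first last.
- by move=> e w _; rewrite lee_fin mulr_ge0// prodr_ge0.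
- move=> e; apply/measurable_EFinP.
  by apply: measurable_funM => //; exact: measurable_indic.
transitivity (\sum_(e : {ffun I -> bool}) (H e * \prod_i (if e i then q else 1 - q))%:E)%E.
  apply: eq_bigr => e _.
  under eq_integral do rewrite EFinM.
  rewrite ge0_integralZl//.
  - rewrite integral_indic// setIT EFinM; congr (_ * _)%E; exact: PD.
  - by apply/measurable_EFinP; exact: measurable_indic.
  - by rewrite lee_fin; apply: prodr_ge0.
rewrite sumEFin; congr EFin.
transitivity (\sum_(e : {ffun I -> bool}) \prod_i
   (h i (e i)%:R * if e i then q else 1 - q)).
  by apply: eq_bigr => e _; rewrite big_split.
rewrite -(bigA_distr_bigA (fun i (b : bool) => h i b%:R * if b then q else 1 - q)).
by apply: eq_bigr => i _; rewrite big_bool/= addrC ![h _ _ * _]mulrC.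
Unshelve. all: by end_near.
Qed.

(** For a fixed configuration the Boltzmann factor is a product over pairs of functions of single
    edges. Since [h] is non-negative, sum and integral are exchanged without any integrability
    argument. *)
Lemma expectation_partition_fun (R : realType) (d : measure_display)
    (T : measurableType d) (P : probability T R) (N : nat) (q beta : R)
    (eps : 'I_N -> 'I_N -> {RV P >-> R}) (h : R -> R) :
  mutually_independent (fun ij : 'I_N * 'I_N => eps ij.1 ij.2) ->
  (forall i j, P [set w | eps i j w = 1] = q%:E) ->
  (forall i j, P [set w | eps i j w = 0] = (1 - q)%:E) ->
  (forall x, 0 <= h x) ->
  fine 'E_P[fun w => partition_fun q beta h (fun i j => eps i j w)] =
  \sum_(s : config N)
    (\prod_(ij : 'I_N * 'I_N)
       (1 - q + q * expR (beta / (2 * N%:R * q) * (spin R s ij.1 * spin R s ij.2))))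
    * h ((\sum_(i < N) spin R s i) / Num.sqrt N%:R).
Proof.
move=> epsI eps1 eps0 h0.
pose k (s : config N) (ij : 'I_N * 'I_N) (x : R) : R :=
  expR (beta / (2 * N%:R * q) * (spin R s ij.1 * spin R s ij.2) * x).
have mk s ij : measurable_fun setT (k s ij).
  apply: measurableT_comp; first exact: measurable_expR.
  by apply: measurable_funM => //; exact: measurable_cst.
pose f s w := \prod_(ij : 'I_N * 'I_N) k s ij (eps ij.1 ij.2 w).
have mf s : measurable_fun setT (f s).
  by apply: measurable_prod => ij _; exact: measurableT_comp.
have f0 s w : 0 <= f s w by apply: prodr_ge0 => ij _; exact: expR_ge0.
rewrite unlock /partition_fun.
pose c s := h ((\sum_(i < N) spin R s i) / Num.sqrt N%:R).
transitivity (fine (\int[P]_w (\sum_(s : config N) (c s)%:E * (f s w)%:E))%E).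
  congr fine; apply: eq_integral => w _; rewrite -sumEFin; apply: eq_bigr => s _.
  rewrite EFinM muleC; congr (_ * _%:E)%E.
  rewrite /f /k -expR_sum; congr expR.
  rewrite /hamiltonian mulrA mulrNN mul1r mulr_sumr.
  rewrite -(pair_bigA _ (fun i j =>
    beta / (2 * N%:R * q) * (spin R s i * spin R s j) * eps i j w))/=.
  apply: eq_bigr => i _; rewrite mulr_sumr; apply: eq_bigr => j _.
  by ring.
rewrite ge0_integral_sum//; first last.
- by move=> s w _; rewrite -EFinM lee_fin mulr_ge0// h0.
- move=> s; apply: emeasurable_funM => //; exact/measurable_EFinP.
pose G s := \prod_(ij : 'I_N * 'I_N)
  (1 - q + q * expR (beta / (2 * N%:R * q) * (spin R s ij.1 * spin R s ij.2))).
rewrite (eq_bigr (fun s => (c s * G s)%:E)) => [|s _]; last first.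
  rewrite ge0_integralZl//; last 3 first.
  - exact/measurable_EFinP.
  - by move=> w _; rewrite lee_fin.
  - by rewrite lee_fin h0.
  rewrite (@independent_binary_prod_expectation _ _ _ _ _ _ q)//; last first.
    by move=> ij x; exact: expR_ge0.
  rewrite EFinM; congr (_ * _%:E)%E; apply: eq_bigr => ij _.
  by rewrite /k mulr0 mulr1 expR0 mulr1.
by rewrite sumEFin /=; apply: eq_bigr => s _; rewrite mulrC.
Qed.

Lemma sum_config_spin (R : realType) (N : nat) (F : R -> R) :
  \sum_(s : config N) F (\sum_(i < N) spin R s i) =
  \sum_(m < N.+1) 'C(N, m)%:R * F (2 * m%:R - N%:R).
Proof.
(* [false] encodes the spin +1, so [A] is exactly the set of plus spins. *)
pose conf (A : {set 'I_N}) : config N := [ffun i => i \notin A].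
have conf_bij : bijective conf.
  exists (fun s : config N => [set i | ~~ s i]%SET) => [A|s].
    by apply/setP => i; rewrite inE ffunE negbK.
  by apply/ffunP => i; rewrite ffunE inE negbK.
have spin_sum A : \sum_(i < N) spin R (conf A) i = 2 * #|A|%:R - N%:R.
  transitivity (\sum_(i < N) (2 * (i \in A)%:R - 1) : R).
    by apply: eq_bigr => i _; rewrite /spin ffunE; case: (i \in A) => /=; ring.
  rewrite big_split/= -mulr_sumr sumrN -natr_sum; congr (2 * _%:R - _).
    by rewrite -sum1_card [RHS]big_mkcond; apply: eq_bigr => i _; case: ifP.
  by rewrite sumr_const card_ord.
rewrite (reindex conf); last exact: onW_bij.
have leN (A : {set 'I_N}) : (#|A| < N.+1)%N.
  by rewrite ltnS -[leqRHS]card_ord max_card.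
rewrite (partition_big (fun A : {set 'I_N} => Ordinal (leN A)) predT)//=.
apply: eq_bigr => m _.
rewrite (eq_bigr (fun=> F (2 * m%:R - N%:R))); last first.
  by move=> A /eqP <-; rewrite spin_sum.
rewrite sumr_const -[LHS]mulr_natl; congr (_%:R * _).
transitivity #|[set A : {set 'I_N} | #|A| == m]%SET|; last first.
  by rewrite card_draws card_ord.
by apply: eq_card => A; rewrite !inE.
Qed.

(** On the two signs, [ln (w t)] agrees with the affine function [(a + b) / 2 + (a - b) / 2 * t].
    Summed over all pairs, diagonal included, [s_i s_j] gives the square of the total spin. *)
Lemma prod_spin_pairs (R : realType) (N : nat) (s : config N) (w : R -> R) :
  (forall x, 0 < w x) ->
  \prod_(ij : 'I_N * 'I_N) w (spin R s ij.1 * spin R s ij.2) =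
  expR (N%:R ^+ 2 * (ln (w 1) + ln (w (-1))) / 2
        + (ln (w 1) - ln (w (-1))) / 2 * (\sum_(i < N) spin R s i) ^+ 2).
Proof.
move=> w0.
set a := ln (w 1); set b := ln (w (-1)).
transitivity (\prod_(ij : 'I_N * 'I_N)
    expR ((a + b) / 2 + (a - b) / 2 * (spin R s ij.1 * spin R s ij.2))).
  apply: eq_bigr => ij _; rewrite /spin -signr_addb; case: (_ (+) _) => /=.
    rewrite expr1 [X in expR X](_ : _ = b); last by field.
    by rewrite lnK// posrE.
  rewrite expr0 [X in expR X](_ : _ = a); last by field.
  by rewrite lnK// posrE.
rewrite -expR_sum; congr expR; rewrite big_split/=; congr (_ + _).
  by rewrite sumr_const card_prod card_ord -[LHS]mulr_natl natrM expr2 !mulrA.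
rewrite -mulr_sumr; congr (_ * _).
rewrite -(pair_bigA _ (fun i j => spin R s i * spin R s j))/= expr2 mulr_suml.
by apply: eq_bigr => i _; rewrite mulr_sumr.
Qed.

(** * Elementary inequalities *)

Lemma ge0_derive_ge_at0 (R : realType) (f f' : R -> R) :
  (forall x : R, is_derive x (1 : R) f (f' x)) -> (forall x, 0 <= x -> 0 <= f' x) ->
  forall x, 0 <= x -> f 0 <= f x.
Proof.
move=> df f'0 x x0.
have cf : continuous f.
  move=> y; apply: differentiable_continuous; apply/derivable1_diffP.
  by have [] := df y.
apply: (@ger0_derive1_ndecr _ f 0 x) => //; last exact: continuous_subspaceT.
move=> y; rewrite in_itv/= => /andP[y0 _]; rewrite derive1E derive_val.
by rewrite f'0// ltW.
Qed.

(** The derivative of the difference is non-negative because [1 - 2x <= expR (- 2x)]. The inequality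
    bounds the ratio of consecutive weights by 1; multiplied by [expR (- u)] it also says
    [tanh u <= u], the form used in [cosh_bounds]. *)
Lemma expR_double_le_ratio (R : realType) (u : R) : 0 <= u ->
  (1 - u) * expR (2 * u) <= 1 + u.
Proof.
move=> u0; rewrite -subr_ge0.
pose f x : R := 1 + x - (1 - x) * expR (2 * x).
pose f' x : R := 1 - (1 - 2 * x) * expR (2 * x).
have -> : 0 = f 0 by rewrite /f mulr0 expR0; ring.
apply: (@ge0_derive_ge_at0 _ _ f') => // x.
  rewrite /f /f'; apply: is_derive_eq; rewrite /GRing.scale/=; ring.
rewrite /f' => x0; rewrite subr_ge0 -ler_pdivlMr ?expR_gt0// mul1r -expRN.
exact: expR_ge1Dx.
Qed.

Lemma sinh_ge_id (R : realType) (x : R) : 0 <= x -> 2 * x <= expR x - expR (- x).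
Proof.
move=> x0; rewrite -subr_ge0.
pose f x : R := expR x - expR (- x) - 2 * x.
pose f' x : R := expR x + expR (- x) - 2.
have -> : 0 = f 0 by rewrite /f oppr0 expR0; ring.
apply: (@ge0_derive_ge_at0 _ _ f') => // y.
  rewrite /f /f'; apply: is_derive_eq; rewrite /GRing.scale/=; ring.
move=> _; rewrite /f'.
have := expR_ge1Dx y; have := expR_ge1Dx (- y); lra.
Qed.

(** The lower bound is the upper bound applied to the inverse [1 - t / (1 + t)] of [1 + t]. *)
Lemma ln1D_bounds (R : realType) (t : R) : -1 < t -> t / (1 + t) <= ln (1 + t) <= t.
Proof.
move=> t1; have t0 : 0 < 1 + t by rewrite -ltrBlDl sub0r.
rewrite le_ln1Dx// andbT -lerN2 -lnV ?posrE//.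
have E : (1 + t)^-1 = 1 + - (t / (1 + t)) by field; rewrite gt_eqF.
rewrite {1}E; apply: le_ln1Dx; rewrite ltrN2 ltr_pdivrMr// mul1r ltrDr//.
Qed.

(* The logarithm of the mean of [exp(x eps)] for a Bernoulli([q]) variable [eps]. *)
Definition log_edge (R : realType) (q x : R) : R := ln (1 - q + q * expR x).

(** The errors are factors [expR x] and [expR (- x)] that do not depend on [q], so the bounds
    survive [q] tending to 0. Both logarithms are estimated by [ln1D_bounds] at
    [t = q (expR (+-x) - 1)]. *)
Lemma log_edge_diff_bounds (R : realType) (q x : R) : 0 < q <= 1 -> 0 <= x ->
  2 * (q * x) * expR (- x) <= log_edge R q x - log_edge R q (- x) <= 2 * (q * x) * expR x.
Proof.
move=> /andP[q0 q1] x0; rewrite /log_edge.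
have E0 := expR_gt0 x; have e0 := expR_gt0 (- x).
have Ee : expR x * expR (- x) = 1 by rewrite -expRD subrr expR0.
have Ex := expR_ge1Dx x; have ex := expR_ge1Dx (- x).
have E1 : 1 <= expR x by lra.
have e1 : expR (- x) <= 1 by nra.
have -> : 1 - q + q * expR x = 1 + q * (expR x - 1) by ring.
have -> : 1 - q + q * expR (- x) = 1 + q * (expR (- x) - 1) by ring.
set E := expR x in E0 Ee Ex E1 *; set e := expR (- x) in e0 Ee ex e1 *.
have Ele : E - 1 <= x * E by nra.
have ege : 1 - e <= x by lra.
have ele : x * e <= 1 - e by nra.
have /ln1D_bounds/andP[P1 P2] : -1 < q * (E - 1) by nra.
have /ln1D_bounds/andP[M1 M2] : -1 < q * (e - 1) by nra.
(* As [q <= 1], the denominator is at most [E], whose inverse is [e]; in [M3] the denominator is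
   likewise at least [e]. *)
have P3 : q * x * e <= q * (E - 1) / (1 + q * (E - 1)).
  rewrite ler_pdivlMr; last by nra.
  have H1 : 1 + q * (E - 1) <= E by nra.
  apply: (@le_trans _ _ (q * x * e * E)).
    by rewrite ler_wpM2l// !mulr_ge0// ltW.
  by rewrite -mulrA (mulrC e) Ee mulr1 ler_pM2l//; lra.
have M3 : - (q * x * E) <= q * (e - 1) / (1 + q * (e - 1)).
  rewrite ler_pdivlMr; last by nra.
  have H1 : e <= 1 + q * (e - 1) by nra.
  rewrite mulNr lerNl.
  apply: (@le_trans _ _ (q * x * E * e)); last first.
    by rewrite ler_wpM2l// !mulr_ge0// ltW.
  rewrite -mulrA Ee mulr1; nra.
have P4 : q * (E - 1) <= q * (x * E) by rewrite ler_pM2l.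
have M4 : q * (e - 1) <= - (q * (x * e)) by rewrite -mulrN ler_pM2l//; lra.
by apply/andP; split; lra.
Qed.

Lemma log_edge_sum (R : realType) (q x : R) : 0 < q <= 1 ->
  log_edge R q x + log_edge R q (- x) = ln (1 + 2 * q * (1 - q) * (cosh x - 1)).
Proof.
move=> /andP[q0 q1]; rewrite /log_edge -lnM ?posrE.
- have Ee : expR x * expR (- x) = 1 by rewrite -expRD subrr expR0.
  rewrite /cosh; transitivity (ln (1 + 2 * q * (1 - q) * ((expR x + expR (- x)) / 2 - 1)
    + q ^+ 2 * (expR x * expR (- x) - 1))).
    by congr ln; field.
  by rewrite Ee subrr mulr0 addr0.
- by have := expR_gt0 x; nra.
- by have := expR_gt0 (- x); nra.
Qed.

(** With [S y = 2 sinh y], one has [cosh x - 1 = S (x / 2) ^+ 2 / 2], so it suffices to show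
    [x <= S (x / 2) <= x + x ^+ 3 / 5]. *)
Lemma cosh_bounds (R : realType) (x : R) : 0 <= x <= 1 ->
  x ^+ 2 / 2 <= cosh x - 1 <= x ^+ 2 / 2 + x ^+ 4.
Proof.
move=> /andP[x0 x1].
pose S (y : R) := expR y - expR (- y).
have SS y : expR (2 * y) + expR (- (2 * y)) = 2 + S y ^+ 2.
  have Ee : expR y * expR (- y) = 1 by rewrite -expRD subrr expR0.
  rewrite /S (_ : 2 * y = y + y); last by ring.
  rewrite opprD !expRD.
  transitivity ((expR y - expR (- y)) ^+ 2 + 2 * (expR y * expR (- y))); first by ring.
  by rewrite Ee; ring.
have Sle y : 0 <= y -> S y <= y * (expR y + expR (- y)).
  move=> y0; have h := expR_double_le_ratio _ y y0.
  have Ee : expR y * expR (- y) = 1 by rewrite -expRD subrr expR0.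
  move: h; rewrite (_ : 2 * y = y + y); last by ring.
  rewrite expRD /S => h.
  have e0 := expR_gt0 (- y).
  have : (1 - y) * (expR y * expR y) * expR (- y) <= (1 + y) * expR (- y).
    by rewrite ler_pM2r.
  rewrite -!mulrA Ee; nra.
have -> : cosh x - 1 = S (x / 2) ^+ 2 / 2.
  by have := SS (x / 2); rewrite mulrC divfK// /cosh => ->; field.
have S0 : 2 * (x / 2) <= S (x / 2) by apply: sinh_ge_id; lra.
(* Here [S (x / 2) <= x / 2 * (2 + S (x / 4) ^+ 2)], and a crude bound on [S (x / 4)] suffices: the
   factor 7/3 is 4/3 + 1, bounding [expR (x / 4)] and [expR (- (x / 4))]. This gives the coefficient
   49/288, below 1/5. *)
have Sx : S (x / 2) <= x + x ^+ 3 / 5.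
  apply: (le_trans (Sle _ _)); first by lra.
  have -> : x / 2 = 2 * (x / 4) by field.
  rewrite SS.
  have S4 : S (x / 4) <= x / 4 * (7 / 3).
    apply: (le_trans (Sle _ _)); first by lra.
    rewrite ler_wpM2l//; first by lra.
    have e1 : expR (- (x / 4)) <= 1 by rewrite -[leRHS]expR0 ler_expR; lra.
    have := expR_ge1Dx (- (x / 4)).
    have Ee : expR (x / 4) * expR (- (x / 4)) = 1 by rewrite -expRD subrr expR0.
    have E0 := expR_gt0 (x / 4).
    nra.
  have S40 : 2 * (x / 4) <= S (x / 4) by apply: sinh_ge_id; lra.
  have S42 : S (x / 4) ^+ 2 <= (x / 4 * (7 / 3)) ^+ 2.
    by rewrite lerXn2r// nnegrE; lra.
  have x3 : 0 <= x ^+ 3 by rewrite exprn_ge0.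
  rewrite mulrDr -lerBrDl.
  apply: (@le_trans _ _ (2 * (x / 4) * (x / 4 * (7 / 3)) ^+ 2)).
    by rewrite ler_wpM2l//; lra.
  lra.
have x2 : 0 <= x ^+ 2 by rewrite exprn_ge0.
have x3 : 0 <= x ^+ 3 by rewrite exprn_ge0.
have x4 : 0 <= x ^+ 4 by rewrite exprn_ge0.
have x64 : x ^+ 6 <= x ^+ 4 by rewrite ler_wiXn2l.
apply/andP; split; rewrite -?mulrDl.
  rewrite ler_pM2r// lerXn2r// ?nnegrE; lra.
apply: (@le_trans _ _ ((x + x ^+ 3 / 5) ^+ 2 / 2)).
  by rewrite ler_pM2r// lerXn2r// ?nnegrE; lra.
lra.
Qed.

(** With [u = 2 q (1 - q) (cosh x - 1)], [ln (1 + u)] lies between [u - u ^+ 2] and [u], and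
    [u <= 3 q x ^+ 2]; so the error is at most 9/2 of [q ^+ 2 * x ^+ 4]. The factor [q ^+ 2] keeps
    it small after multiplication by [N ^+ 2]. *)
Lemma log_edge_sum_bounds (R : realType) (q x : R) : 0 < q <= 1 -> 0 <= x <= 1 ->
  `|(log_edge R q x + log_edge R q (- x)) / 2 - q * (1 - q) * (cosh x - 1)|
  <= 5 * q ^+ 2 * x ^+ 4.
Proof.
move=> q01 x01; rewrite log_edge_sum//.
have /andP[C1 C2] := cosh_bounds _ _ x01.
move: x01 q01 => /andP[x0 x1] /andP[q0 q1].
set C := cosh x - 1 in C1 C2 *.
have x2 : 0 <= x ^+ 2 by rewrite exprn_ge0.
have x42 : x ^+ 4 <= x ^+ 2 by rewrite ler_wiXn2l.
have C0 : 0 <= C by lra.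
have C3 : C <= 3 / 2 * x ^+ 2 by lra.
pose u := 2 * q * (1 - q) * C.
have u0 : 0 <= u by rewrite !mulr_ge0// ?subr_ge0// ltW.
have /ln1D_bounds/andP[L1 L2] : -1 < u by lra.
have uu : u - u ^+ 2 <= u / (1 + u).
  rewrite ler_pdivlMr; last by lra.
  by have : 0 <= u ^+ 3 by [rewrite exprn_ge0]; lra.
have uC : u <= 3 * q * x ^+ 2.
  have h1 : q * (1 - q) <= q by nra.
  have : q * (1 - q) * C <= q * (3 / 2 * x ^+ 2).
    apply: ler_pM => //; first by rewrite mulr_ge0// ?subr_ge0// ltW.
  rewrite /u; lra.
have u2 : u ^+ 2 <= 9 * q ^+ 2 * x ^+ 4.
  rewrite (_ : _ * x ^+ 4 = (3 * q * x ^+ 2) ^+ 2); last by ring.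
  by rewrite lerXn2r// nnegrE (le_trans u0).
have q2 : 0 <= q ^+ 2 * x ^+ 4 by rewrite mulr_ge0 ?exprn_ge0// ltW.
rewrite -/u (_ : q * (1 - q) * C = u / 2); last by rewrite /u; field.
rewrite ler_norml; apply/andP; split; lra.
Qed.

(** * A local limit theorem for binomial coefficients *)

(* Removing the discrete Gaussian from the binomial coefficient; the variance
   [N + 1] instead of [N] makes the quotient of consecutive weights a function
   of a single variable [u], see [bin_weightS]. *)
Definition bin_weight (R : realType) (N m : nat) : R :=
  'C(N, m)%:R * expR ((2 * m%:R - N%:R) ^+ 2 / (2 * N.+1%:R)).

(** The binomial ratio [(N - m) / (m + 1)] is [(1 - u) / (1 + u)], and the squares in the exponent
    differ by [4 (2m + 1 - N)], which contributes exactly [2u]. *)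
Lemma bin_weightS (R : realType) (N m : nat) : (m < N)%N ->
  let u : R := (2 * m%:R + 1 - N%:R) / N.+1%:R in
  bin_weight R N m.+1 = bin_weight R N m * ((1 - u) / (1 + u) * expR (2 * u)).
Proof.
move=> mN u.
have N0 : N.+1%:R != 0 :> R by rewrite pnatr_eq0.
have m0 : m.+1%:R != 0 :> R by rewrite pnatr_eq0.
have uE : 1 + u = 2 * m.+1%:R / N.+1%:R.
  by rewrite /u -[m.+1]addn1 -[N.+1]addn1 !natrD; field; rewrite natr1.
have u'E : 1 - u = 2 * (N%:R - m%:R) / N.+1%:R.
  by rewrite /u -[N.+1]addn1 !natrD; field; rewrite natr1.
have /(congr1 (fun n => n%:R : R)) := mul_bin_left N m.
rewrite !natrM natrB 1?ltnW// => binE.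
have -> : (1 - u) / (1 + u) = (N%:R - m%:R) / m.+1%:R.
  by rewrite uE u'E; field; rewrite !nat1r m0.
rewrite /bin_weight mulrACA -expRD; congr (_ * expR _).
  by apply: (mulfI m0); rewrite binE; field; rewrite nat1r m0.
by rewrite /u -[m.+1]addn1 -[N.+1]addn1 !natrD; field; rewrite natr1.
Qed.

Lemma bin_weight_sym (R : realType) (N m : nat) : (m <= N)%N ->
  bin_weight R N (N - m) = bin_weight R N m.
Proof.
move=> mN; rewrite /bin_weight bin_sub// natrB//.
by rewrite (_ : 2 * (N%:R - m%:R) - N%:R = - (2 * m%:R - N%:R)) ?sqrrN//; ring.
Qed.

Lemma bin_weight_gt0 (R : realType) (N m : nat) : (m <= N)%N -> 0 < bin_weight R N m.
Proof. by move=> mN; rewrite mulr_gt0 ?expR_gt0// ltr0n bin_gt0. Qed.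

Lemma bin_weight_center_gt0 (R : realType) (N : nat) : 0 < bin_weight R N (uphalf N).
Proof. by apply: bin_weight_gt0; lia. Qed.

(** The second hypothesis says [u >= 0]. The lower bound follows from [expR (2u) >= 1 + 2u], since
    [(1 - u) (1 + 2u)] exceeds [(1 - 2u^2) (1 + u)] by [2u^3]. *)
Lemma bin_weightS_bounds (R : realType) (N m : nat) : (m < N)%N -> (N <= 2 * m + 1)%N ->
  let u : R := (2 * m%:R + 1 - N%:R) / N.+1%:R in
  bin_weight R N m * (1 - 2 * u ^+ 2) <= bin_weight R N m.+1
  /\ bin_weight R N m.+1 <= bin_weight R N m.
Proof.
move=> mN Nm u; rewrite (bin_weightS R N m mN) -/u.
have u0 : 0 <= u.
  by rewrite divr_ge0// subr_ge0 -natrM natr1 ler_nat -addn1.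
have u1 : 0 < 1 + u by lra.
have w0 := bin_weight_gt0 R N m (ltnW mN).
split.
  rewrite ler_pM2l// mulrAC ler_pdivlMr//.
  have ul1 : u <= 1.
    rewrite ler_pdivrMr ?ltr0n// mul1r lerBlDr -natrM natr1 -natrD ler_nat.
    by move: mN; rewrite -[(2 * m)%N]/(m + (m + 0))%N; lia.
  have e := expR_ge1Dx (2 * u).
  apply: (@le_trans _ _ ((1 - u) * (1 + 2 * u))); first nra.
  by rewrite ler_wpM2l// subr_ge0.
rewrite ler_piMr ?(ltW w0)// mulrAC ler_pdivrMr// mul1r.
exact: expR_double_le_ratio.
Qed.

(** From [uphalf N] to the right every step has [u >= 0], so the weights do not increase; the left
    half follows by reflection. *)
Lemma bin_weight_le_center (R : realType) (N m : nat) : (m <= N)%N ->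
  bin_weight R N m <= bin_weight R N (uphalf N).
Proof.
have hN : (N <= 2 * uphalf N)%N by lia.
have right j : (uphalf N + j <= N)%N ->
    bin_weight R N (uphalf N + j) <= bin_weight R N (uphalf N).
  elim: j => [|j IH] jN; first by rewrite addn0.
  rewrite addnS in jN *.
  apply: le_trans (IH (ltnW jN)).
  have Nj : (N <= 2 * (uphalf N + j) + 1)%N by lia.
  by have [] := bin_weightS_bounds R _ _ jN Nj.
move=> mN; have [hm|mh] := leqP (uphalf N) m.
  by rewrite -(subnKC hm); apply: right; rewrite subnKC.
rewrite -(bin_weight_sym _ _ _ mN).
have hm : (uphalf N <= N - m)%N by lia.
by rewrite -(subnKC hm); apply: right; rewrite subnKC// leq_subr.
Qed.

(** Put [t = |2m - N|]. At most [t] steps lead from the centre to [m] or its mirror image, each with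
    [u <= t / (N + 1)] and hence losing at most [2 (t / (N + 1)) ^+ 2] of the central weight. *)
Lemma bin_weight_ge_center (R : realType) (N m : nat) : (m <= N)%N ->
  bin_weight R N (uphalf N) * (1 - 2 * `|2 * m%:R - N%:R| ^+ 3 / N.+1%:R ^+ 2)
  <= bin_weight R N m.
Proof.
have hN : (N <= 2 * uphalf N)%N by lia.
have w0 := bin_weight_center_gt0 R N.
(* The loss per step is frozen at its value for the endpoint [J], so that the induction on [j] adds
   equal amounts. *)
have right J j : (j <= J)%N -> (uphalf N + J <= N)%N ->
    bin_weight R N (uphalf N) * (1 - j%:R * (2 * ((2 * (uphalf N + J)%:R - N%:R) / N.+1%:R) ^+ 2))
    <= bin_weight R N (uphalf N + j).
  move=> + JN; elim: j => [|j IH] jJ; first by rewrite addn0 mul0r subr0 mulr1.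
  have /IH{}IH := ltnW jJ.
  rewrite addnS.
  have jN : (uphalf N + j < N)%N by lia.
  have Nj : (N <= 2 * (uphalf N + j) + 1)%N by lia.
  have [+ _] := bin_weightS_bounds R _ _ jN Nj.
  apply: le_trans.
  have wj := bin_weight_le_center R _ _ (ltnW jN).
  set u := (X in 1 - 2 * X ^+ 2).
  set U := (X in _ * (2 * X ^+ 2)) in IH *.
  have u0 : 0 <= u.
    by rewrite divr_ge0// subr_ge0 -natrM natr1 ler_nat -addn1.
  have uU : u <= U.
    rewrite /u /U ler_pM2r ?invr_gt0 ?ltr0n// lerD2r.
    rewrite -!natrM natr1 ler_nat; lia.
  have uU2 : u ^+ 2 <= U ^+ 2 by rewrite lerXn2r// nnegrE// (le_trans u0).
  rewrite -natr1 mulrDl mul1r -/U.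
  set w := bin_weight R N _ in w0 wj IH *; set v := bin_weight R N _ in wj IH *.
  have uw : u ^+ 2 * v <= U ^+ 2 * w.
    apply: ler_pM => //; first exact: sqr_ge0.
    by rewrite ltW// bin_weight_gt0// ltnW.
  nra.
have key k : (uphalf N <= k <= N)%N ->
  bin_weight R N (uphalf N) * (1 - 2 * `|2 * k%:R - N%:R| ^+ 3 / N.+1%:R ^+ 2)
  <= bin_weight R N k.
  move=> /andP[hk kN].
  have := right _ _ (leqnn (k - uphalf N)); rewrite subnKC// => /(_ kN).
  apply: le_trans.
  rewrite ler_pM2l// lerD2l lerN2.
  have t0 : 0 <= 2 * k%:R - N%:R :> R by rewrite subr_ge0 -natrM ler_nat; lia.
  rewrite ger0_norm//.
  set t := 2 * k%:R - N%:R.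
  have jt : (k - uphalf N)%:R <= t.
    rewrite /t lerBrDr -natrM -natrD ler_nat; lia.
  rewrite [leRHS](_ : _ = t * (2 * (t / N.+1%:R) ^+ 2)).
    by rewrite ler_wpM2r// mulr_ge0// sqr_ge0.
  by field; rewrite nat1r.
move=> mN; have [hm|mh] := leqP (uphalf N) m; first by apply: key; rewrite hm.
rewrite -(bin_weight_sym _ _ _ mN).
have hm : (uphalf N <= N - m <= N)%N by rewrite leq_subr andbT; lia.
have := key _ hm; rewrite natrB//.
by rewrite (_ : 2 * (N%:R - m%:R) - N%:R = - (2 * m%:R - N%:R)) ?normrN//; ring.
Qed.

(** * Binomial sums as integrals of step functions *)

Lemma sqrtn_cvgy (R : realType) : Num.sqrt (N%:R : R) @[N --> \oo] --> +oo.
Proof.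
apply/cvgryPge => A; have /cvgryPge/(_ (A ^+ 2)) := @cvgr_idn R.
apply: filterS => N AN; apply: (le_trans (ler_norm _)).
by rewrite -sqrtr_sqr ler_sqrt.
Qed.

Lemma inv_sqrtn_cvg0 (R : realType) : (Num.sqrt (N%:R : R))^-1 @[N --> \oo] --> 0.
Proof.
apply/gtr0_cvgV0; last exact: sqrtn_cvgy.
by near=> N; rewrite sqrtr_gt0 ltr0n; near: N; exact: nbhs_infty_gt.
Unshelve. all: by end_near. Qed.

Lemma ratio_succ_cvg1 (R : realType) : (N%:R / N.+1%:R : R) @[N --> \oo] --> (1 : R).
Proof.
rewrite (_ : (fun N => _) = fun N : nat => 1 - harmonic N); last first.
  by apply/funext => N; rewrite /harmonic /= -[N.+1]addn1 natrD; field; rewrite natr1.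
by rewrite -[X in _ --> X]subr0; apply: cvgB; [exact: cvg_cst|exact: cvg_harmonic].
Qed.

(** The normalised total spin with [m] plus spins. The index [m = N + 1] also occurs, as the right
    end of the last interval of [step_fun]. *)
Definition spin_node (R : realType) (N m : nat) : R :=
  (2 * m%:R - N%:R) / Num.sqrt N%:R.

(* Intervals of length [2 / sqrt N], the spacing of the values of the
   normalised total spin. *)
Definition step_fun (R : realType) (N : nat) (G : nat -> R) (x : R) : R :=
  \sum_(m < N.+1) G m * \1_(`[spin_node R N m, spin_node R N m.+1[) x.

Lemma sqrtn_gt0 (R : realType) (N : nat) : (0 < N)%N -> 0 < Num.sqrt (N%:R : R).
Proof. by move=> N0; rewrite sqrtr_gt0 ltr0n. Qed.

Lemma spin_nodeS (R : realType) (N m : nat) :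
  spin_node R N m.+1 = spin_node R N m + 2 / Num.sqrt N%:R.
Proof. by rewrite /spin_node -mulrDl -natr1; congr (_ / _); ring. Qed.

(** In this form [truncn] recovers the index from [x]; this yields both the disjointness of the
    intervals and the choice of the node near [x]. *)
Lemma mem_spin_itv (R : realType) (N m : nat) (x : R) : (0 < N)%N ->
  (x \in `[spin_node R N m, spin_node R N m.+1[) =
  (m%:R <= (x * Num.sqrt N%:R + N%:R) / 2 < m.+1%:R).
Proof.
move=> N0; have s0 := sqrtn_gt0 R N N0.
rewrite in_itv/= /spin_node ler_pdivrMr// ltr_pdivlMr//.
rewrite lerBlDr ltrBrDr ler_pdivlMr// ltr_pdivrMr//.
by rewrite ![2 * _]mulrC.
Qed.

Lemma step_fun_at (R : realType) (N m : nat) (G : nat -> R) (x : R) : (0 < N)%N ->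
  (m <= N)%N -> x \in `[spin_node R N m, spin_node R N m.+1[ -> step_fun R N G x = G m.
Proof.
move=> N0 mN xm; have mN' : (m < N.+1)%N by [].
rewrite /step_fun (bigD1 (Ordinal mN'))//= big1 ?addr0 => [|i im].
  by rewrite indicE mem_set ?mulr1.
rewrite indicE memNset ?mulr0// => xi.
have {}xi : x \in `[spin_node R N i, spin_node R N i.+1[ by [].
move: xm xi; rewrite !mem_spin_itv// => /truncn_def Em /truncn_def Ei.
by move/eqP: im; apply; apply: val_inj; rewrite /= -Em -Ei.
Qed.

Lemma step_fun_cases (R : realType) (N : nat) (G : nat -> R) (x : R) : (0 < N)%N ->
  step_fun R N G x = 0 \/
  exists m, [/\ (m <= N)%N, `|spin_node R N m - x| <= 2 / Num.sqrt N%:R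
             & step_fun R N G x = G m].
Proof.
move=> N0.
have [[m [mN xm]]|H] := pselect (exists m, (m <= N)%N /\
    x \in `[spin_node R N m, spin_node R N m.+1[).
  right; exists m; split => //; last exact: step_fun_at.
  move: xm; rewrite in_itv/= spin_nodeS => /andP[xm mx].
  by rewrite distrC ger0_norm ?subr_ge0// lerBlDl ltW.
left; rewrite /step_fun big1// => i _; rewrite indicE memNset ?mulr0// => xi.
by apply: H; exists i; split => //; rewrite -ltnS.
Qed.

Lemma measurable_step_fun (R : realType) (N : nat) (G : nat -> R) :
  measurable_fun setT (step_fun R N G).
Proof.
by apply: measurable_sum => m; apply: measurable_funM => //; exact: measurable_indic.
Qed.

Lemma integral_step_fun (R : realType) (N : nat) (G : nat -> R) : (0 < N)%N ->
  (forall m, 0 <= G m) ->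
  (\int[lebesgue_measure]_x (step_fun R N G x)%:E)%E =
  (2 / Num.sqrt N%:R * \sum_(m < N.+1) G m)%:E.
Proof.
move=> N0 G0; under eq_integral do rewrite -sumEFin.
rewrite ge0_integral_sum//; first last.
- by move=> m x _; rewrite lee_fin mulr_ge0.
- move=> m; apply/measurable_EFinP; exact: measurable_funM.
rewrite mulr_sumr -sumEFin; apply: eq_bigr => m _.
under eq_integral do rewrite EFinM.
rewrite ge0_integralZl//; last 2 first.
- by apply/measurable_EFinP; exact: measurable_indic.
- by rewrite lee_fin.
rewrite integral_indic// setIT [RHS]EFinM muleC; congr (_ * _)%E.
have := lebesgue_measure_itv `[spin_node R N m, spin_node R N m.+1[.
rewrite /= lte_fin spin_nodeS ltrDl divr_gt0 ?sqrtn_gt0// => ->.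
by rewrite -EFinD addrAC subrr add0r.
Qed.

(** Integrability and total mass of this kernel are then inherited from the centred normal density
    of variance [1 / a]. *)
Lemma expR_sqr_half (R : realType) (a x : R) : 0 < a ->
  normal_fun 0 (Num.sqrt a)^-1 x = expR (- (a / 2 * x ^+ 2)).
Proof.
move=> a0; rewrite /normal_fun subr0 exprVn sqr_sqrtr ?ltW//.
by congr expR; rewrite -mulr_natr; field; rewrite gt_eqF.
Qed.

Lemma integrable_expR_sqr (R : realType) (a : R) : 0 < a ->
  lebesgue_measure.-integrable [set: R] (fun x => (expR (- (a / 2 * x ^+ 2)))%:E).
Proof.
move=> a0; have s0 : (Num.sqrt a)^-1 != 0 by rewrite invr_eq0 gt_eqF// sqrtr_gt0.
have k0 := normal_peak_gt0 s0.
have := integrable_normal_pdf 0 (Num.sqrt a)^-1.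
move/(integrableZl measurableT (normal_peak (Num.sqrt a)^-1)^-1).
apply: eq_integrable => // x _.
by rewrite normal_pdfE// -EFinM mulKf ?gt_eqF// expR_sqr_half.
Qed.

Lemma integral_expR_sqr (R : realType) (a : R) : 0 < a ->
  (\int[lebesgue_measure]_x (expR (- (a / 2 * x ^+ 2)))%:E)%E =
  (Num.sqrt (pi *+ 2 / a))%:E.
Proof.
move=> a0; have s0 : (Num.sqrt a)^-1 != 0 by rewrite invr_eq0 gt_eqF// sqrtr_gt0.
have k0 := normal_peak_gt0 s0.
transitivity ((normal_peak (Num.sqrt a)^-1)^-1%:E *
  \int[lebesgue_measure]_x (normal_pdf 0 (Num.sqrt a)^-1 x)%:E)%E.
  rewrite -integralZl//; last exact: integrable_normal_pdf.
  by apply: eq_integral => x _; rewrite normal_pdfE// -EFinM mulKf ?gt_eqF// expR_sqr_half.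
rewrite integral_normal_pdf mule1 /normal_peak invrK exprVn sqr_sqrtr ?ltW//.
by rewrite -mulrnAr mulrC.
Qed.

(** The binomial summand divided by the central weight, split into a ratio tending to 1, a Gaussian
    factor and the test function, whose limits are taken separately. *)
Definition node_density (R : realType) (F : nat -> R -> R) (N m : nat) : R :=
  bin_weight R N m / bin_weight R N (uphalf N)
  * expR (- ((2 * m%:R - N%:R) ^+ 2 / (2 * N.+1%:R))) * F N (spin_node R N m).

Lemma sqr_spin_node (R : realType) (N m : nat) : (0 < N)%N ->
  (2 * m%:R - N%:R) ^+ 2 = N%:R * spin_node R N m ^+ 2.
Proof.
move=> N0; rewrite /spin_node expr_div_n sqr_sqrtr// mulrCA mulfV ?mulr1//.
by rewrite pnatr_eq0 -lt0n.
Qed.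

Lemma node_density_bin (R : realType) (F : nat -> R -> R) (N m : nat) :
  'C(N, m)%:R * F N (spin_node R N m) =
  bin_weight R N (uphalf N) * node_density R F N m.
Proof.
have w0 := bin_weight_center_gt0 R N.
rewrite /node_density mulrA; congr (_ * _).
rewrite mulrA (mulrC (bin_weight R N (uphalf N))) divfK ?gt_eqF// /bin_weight -mulrA -expRD subrr.
by rewrite expR0 mulr1.
Qed.

Section step_convergence.
Context (R : realType) (F : nat -> R -> R) (G : R -> R) (B delta : R).
Hypothesis delta0 : 0 < delta.
Hypothesis F0 : forall N y, 0 <= F N y.
Hypothesis F_le : forall N y, F N y * expR (- (y ^+ 2 / 2)) <= B * expR (- (delta * y ^+ 2)).
(** Convergence along moving points is required because the step function evaluates [F N] at a node
    that only approaches [x]. *)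
Hypothesis F_cvg : forall (x : R) (y : nat -> R),
  y N @[N --> \oo] --> x -> F N (y N) @[N --> \oo] --> G x.

Lemma node_density_cvg (x : R) (m : nat -> nat) :
  (\forall N \near \oo, (m N <= N)%N) ->
  spin_node R N (m N) @[N --> \oo] --> x ->
  node_density R F N (m N) @[N --> \oo] --> expR (- (x ^+ 2 / 2)) * G x.
Proof.
move=> mN yx; rewrite /node_density; apply: cvgM; last exact: F_cvg.
rewrite -[X in _ --> X]mul1r; apply: cvgM.
  (* This is the bound of [bin_weight_ge_center] with [2m - N = y * sqrt N], where [y] is the node:
     [N ^ (3/2) / (N + 1) ^ 2] is at most [1 / sqrt N]. *)
  pose lb N : R := 1 - 2 * (`|spin_node R N (m N)| ^+ 3 * (Num.sqrt N%:R)^-1).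
  apply: (@squeeze_cvgr _ _ _ _ lb (fun=> 1)); last 2 first.
  - rewrite -[X in _ --> X]subr0; apply: cvgB; first exact: cvg_cst.
    rewrite -(mulr0 2); apply: cvgM; first exact: cvg_cst.
    rewrite -(mulr0 (`|x| ^+ 3)); apply: cvgM; last exact: inv_sqrtn_cvg0.
    have nx : `|spin_node R N (m N)| @[N --> \oo] --> `|x| by exact: cvg_norm.
    exact: (cvg_comp _ _ nx (@exprn_continuous _ 3 _)).
  - exact: cvg_cst.
  near=> N.
  have N0 : (0 < N)%N by near: N; exact: nbhs_infty_gt.
  have mNN : (m N <= N)%N by near: N.
  have s0 := sqrtn_gt0 R N N0.
  have w0 := bin_weight_center_gt0 R N.
  rewrite ler_pdivrMr// mul1r bin_weight_le_center// andbT.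
  rewrite ler_pdivlMr// mulrC; apply: le_trans (bin_weight_ge_center R _ _ mNN).
  rewrite ler_pM2l// lerD2l lerN2 -mulrA ler_pM2l//.
  have -> : 2 * (m N)%:R - N%:R = spin_node R N (m N) * Num.sqrt N%:R.
    by rewrite divfK// gt_eqF.
  rewrite normrM (gtr0_norm s0) exprMn -mulrA ler_wpM2l//.
  rewrite ler_pdivrMr ?exprn_gt0 ?ltr0n// mulrC ler_pdivlMr//.
  rewrite -exprSr -[4%N]/(2 * 2)%N exprM sqr_sqrtr// lerXn2r ?nnegrE//.
  by rewrite ler_nat.
apply: (@cvg_comp _ _ _ _ expR) (@continuous_expR R _).
apply: cvgN.
apply: (@cvg_trans _ ((fun N : nat => (N%:R / N.+1%:R) * (spin_node R N (m N) ^+ 2 / 2)) @ \oo)).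
  apply: near_eq_cvg; near=> N.
  have N0 : (0 < N)%N by near: N; exact: nbhs_infty_gt.
  by rewrite sqr_spin_node//; field; rewrite nat1r.
rewrite -[x ^+ 2 / 2]mul1r; apply: cvgM; first exact: ratio_succ_cvg1.
by apply: cvgM; [rewrite !expr2; exact: cvgM|exact: cvg_cst].
Unshelve. all: by end_near. Qed.

Lemma step_fun_cvg (x : R) :
  step_fun R N (node_density R F N) x @[N --> \oo] --> expR (- (x ^+ 2 / 2)) * G x.
Proof.
(* The index of the interval containing [x]; it lies between 0 and [N] as soon as
   [|x| <= sqrt N]. *)
pose m N := Num.truncn ((x * Num.sqrt N%:R + N%:R) / 2).
have mP : \forall N \near \oo, [/\ (0 < N)%N, (m N <= N)%N &
    x \in `[spin_node R N (m N), spin_node R N (m N).+1[].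
  near=> N.
  have N0 : (0 < N)%N by near: N; exact: nbhs_infty_gt.
  have s0 := sqrtn_gt0 R N N0.
  have xs : `|x| <= Num.sqrt N%:R.
    by near: N; move: `|x|; apply/cvgryPge; exact: sqrtn_cvgy.
  have NE : N%:R = Num.sqrt N%:R * Num.sqrt N%:R :> R by rewrite -expr2 sqr_sqrtr.
  have v0 : 0 <= (x * Num.sqrt N%:R + N%:R) / 2.
    rewrite divr_ge0// {2}NE -mulrDl mulr_ge0 ?(ltW s0)//.
    by move: xs; rewrite ler_norml => /andP[x1 x2]; lra.
  have := truncn_itv v0; rewrite -/(m N) => mv.
  split => //; last by rewrite mem_spin_itv.
  have /andP[mv1 _] := mv.
  rewrite -(@ler_nat R); apply: (le_trans mv1).
  rewrite ler_pdivrMr// mulr2n mulrDr mulr1 lerD2r {2}NE ler_pM2r//.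
  by apply: le_trans xs; exact: ler_norm.
apply: (@cvg_trans _ ((fun N => node_density R F N (m N)) @ \oo)).
  by apply: near_eq_cvg; apply: filterS mP => N [N0 mN xm]; rewrite (step_fun_at _ _ (m N)).
apply: node_density_cvg; first by apply: filterS mP => N [].
pose lb N := x - 2 * (Num.sqrt N%:R)^-1.
apply: (@squeeze_cvgr _ _ _ _ lb (fun=> x)).
- apply: filterS mP => N [N0 mN]; rewrite in_itv/= spin_nodeS => /andP[-> xm].
  by rewrite andbT /lb lerBlDr ltW.
- rewrite -[X in _ --> X]subr0; apply: cvgB; first exact: cvg_cst.
  rewrite -(mulr0 2); apply: cvgM; first exact: cvg_cst.
  exact: inv_sqrtn_cvg0.
- exact: cvg_cst.
Unshelve. all: by end_near. Qed.

Lemma node_density_ge0 N m : 0 <= node_density R F N m.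
Proof.
rewrite /node_density mulr_ge0// mulr_ge0 ?expR_ge0//.
by rewrite divr_ge0// mulr_ge0 ?expR_ge0.
Qed.

Let B0 : 0 <= B.
Proof.
have := F_le 0%N 0; rewrite expr0n/= mulr0 mul0r oppr0 expR0 !mulr1.
exact: le_trans.
Qed.

(* On the lattice [y ^+ 2 <= N], so replacing [N / (N + 1)] by [1] in the
   exponent costs at most the factor [expR 2^-1]. *)
Lemma step_fun_dominated N x : (0 < N)%N ->
  `|step_fun R N (node_density R F N) x| <=
  expR (2^-1) * B * expR (4 * delta) * expR (- (delta / 2 * x ^+ 2)).
Proof.
move=> N0; have s0 := sqrtn_gt0 R N N0.
have [->|[m [mN ym ->]]] := step_fun_cases R N (node_density R F N) x N0.
  by rewrite normr0 !mulr_ge0 ?expR_ge0.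
rewrite ger0_norm ?node_density_ge0//.
set y := spin_node R N m in ym *.
have y2N : y ^+ 2 <= N%:R.
  have Np : 0 < N%:R :> R by rewrite ltr0n.
  rewrite -(ler_pM2l Np) -sqr_spin_node// -expr2.
  have mN' : (m%:R : R) <= N%:R by rewrite ler_nat.
  have m0 : 0 <= (m%:R : R) by [].
  by nra.
have w0 := bin_weight_center_gt0 R N.
have w1 : bin_weight R N m / bin_weight R N (uphalf N) <= 1.
  by rewrite ler_pdivrMr// mul1r bin_weight_le_center.
rewrite /node_density.
apply: (@le_trans _ _ (expR 2^-1 * (F N y * expR (- (y ^+ 2 / 2))))).
  rewrite sqr_spin_node// -/y -mulrA.
  rewrite -[leRHS]mul1r; apply: ler_pM => //.
  - by rewrite divr_ge0 ?ltW// bin_weight_gt0.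
  - by rewrite mulr_ge0 ?expR_ge0.
  rewrite [leRHS]mulrCA [leLHS]mulrC ler_wpM2l// -expRD ler_expR.
  rewrite [leLHS](_ : _ = (y ^+ 2 / N.+1%:R) / 2 - y ^+ 2 / 2); last first.
    by field; rewrite nat1r.
  rewrite lerD2r ler_piMl// ler_pdivrMr ?ltr0n// mul1r (le_trans y2N)//.
  by rewrite ler_nat.
rewrite -2!(mulrA (expR _)) -(mulrA B) ler_wpM2l ?expR_ge0//; apply: (le_trans (F_le _ _)).
rewrite ler_wpM2l// -expRD ler_expR.
have d2 : (y - x) ^+ 2 <= 2 ^+ 2.
  rewrite -[leLHS]real_normK ?num_real// lerXn2r ?nnegrE//; apply: (le_trans ym).
  by rewrite ler_pdivrMr// ler_peMr// -[leLHS]sqrtr1 ler_sqrt ?ler1n.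
(* From [x^2 <= 2 y^2 + 2 (y - x)^2]. It moves the Gaussian decay from the node [y] to [x], halving
   the rate and costing the factor [expR (4 * delta)]. *)
have x2 : x ^+ 2 <= 2 * y ^+ 2 + 8.
  by have z0 := sqr_ge0 (2 * y - x); nra.
rewrite -subr_ge0 (_ : _ - _ = delta / 2 * (2 * y ^+ 2 + 8 - x ^+ 2)); last by field.
by rewrite mulr_ge0 ?subr_ge0// divr_ge0// ltW.
Qed.

(** The normalised sum is the integral of [step_fun], to which dominated convergence applies. The
    central weight is left unevaluated. *)
Lemma sum_bin_cvg : measurable_fun setT G ->
  lebesgue_measure.-integrable setT (fun x => (expR (- (x ^+ 2 / 2)) * G x)%:E) /\
  (2 / Num.sqrt N%:R / bin_weight R N (uphalf N)
    * \sum_(m < N.+1) 'C(N, m)%:R * F N (spin_node R N m)) @[N --> \oo] -->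
  fine (\int[lebesgue_measure]_x (expR (- (x ^+ 2 / 2)) * G x)%:E)%E.
Proof.
move=> mG.
(* The spacing [2 / sqrt N] degenerates at [N = 0]; the value 0 there lets the majorant hold for
   every [N]. *)
pose f N x := if (0 < N)%N then (step_fun R N (node_density R F N) x)%:E else 0%E.
pose K := expR (2^-1) * B * expR (4 * delta).
have [||| | |intG _ cvgf] := @dominated_convergence _ _ R lebesgue_measure setT measurableT f
    (fun x => (expR (- (x ^+ 2 / 2)) * G x)%:E)
    (fun x => (K * expR (- (delta / 2 * x ^+ 2)))%:E).
- move=> N; rewrite /f; case: ltnP => // _.
  by apply/measurable_EFinP; exact: measurable_step_fun.
- apply/measurable_EFinP; apply: measurable_funM => //.
  apply: measurableT_comp => //; apply: measurableT_comp => //.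
  by apply: measurable_funM => //; exact: measurable_funX.
- apply: aeW => x _.
  have sx : (step_fun R N (node_density R F N) x)%:E @[N --> \oo] -->
      (expR (- (x ^+ 2 / 2)) * G x)%:E.
    by apply/fine_cvgP; split; [exact: nearW|exact: step_fun_cvg].
  apply: cvg_trans sx.
  apply: near_eq_cvg; near=> N; rewrite /f ifT//.
  by near: N; exact: nbhs_infty_gt.
- under eq_fun do rewrite EFinM.
  by apply: integrableZl => //; exact: integrable_expR_sqr.
- apply: aeW => x N _; rewrite /f; case: ltnP => N0.
    by rewrite /= lee_fin; exact: step_fun_dominated.
  by rewrite abse0 lee_fin !mulr_ge0 ?expR_ge0.
split => //.
move: cvgf; rewrite -[X in _ --> X](fineK (integrable_fin_num measurableT intG)).
move=> /fine_cvg; apply: cvg_trans; apply: near_eq_cvg; near=> N.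
have N0 : (0 < N)%N by near: N; exact: nbhs_infty_gt.
rewrite /= /f N0 integral_step_fun//; last exact: node_density_ge0.
rewrite -(mulrA (2 / _)); congr (_ * _); rewrite mulr_sumr; apply: eq_bigr => m _.
by rewrite node_density_bin mulKf// gt_eqF// bin_weight_center_gt0.
Unshelve. all: by end_near. Qed.

End step_convergence.

(** * Gaussian integrals *)

(** The Radon-Nikodym derivative of [normal_prob] and [normal_pdf] have the same integral over every
    measurable set, hence agree almost everywhere. *)
Lemma integral_normal_prob (R : realType) (m s : R) (f : R -> \bar R) :
  (forall x, 0 <= f x)%E -> measurable_fun setT f ->
  (\int[normal_prob m s]_x f x = \int[lebesgue_measure]_x (f x * (normal_pdf m s x)%:E))%E.
Proof.
move=> f0 mf.
pose h := Radon_Nikodym_SigmaFinite.f (normal_prob m s) lebesgue_measure.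
have dom := normal_prob_dominates m s.
rewrite -(Radon_Nikodym_SigmaFinite.change_of_variables dom f0 measurableT mf).
have ih := Radon_Nikodym_SigmaFinite.f_integrable dom.
apply: ae_eq_integral => //.
- by apply: emeasurable_funM => //; exact: measurable_int ih.
- apply: emeasurable_funM => //; apply/measurable_EFinP.
  exact: measurable_normal_pdf.
- apply: ae_eqe_mul2l => /=; apply: integral_ae_eq => //=.
  + by apply/measurable_EFinP; exact: measurable_normal_pdf.
  + by move=> E _ mE; rewrite -Radon_Nikodym_SigmaFinite.f_integral.
Qed.

Lemma expectation_normal (R : realType) (d : measure_display) (T : measurableType d)
    (Q : probability T R) (xi : {RV Q >-> R}) (f : R -> R) :
  (forall A : set R, measurable A -> distribution Q xi A = normal_prob 0 1 A) ->
  (forall x, 0 <= f x) -> measurable_fun setT f ->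
  ('E_Q[fun w => f (xi w)] =
   \int[lebesgue_measure]_x (normal_peak 1 * (expR (- (x ^+ 2 / 2)) * f x))%:E)%E.
Proof.
move=> xiN f0 mf; rewrite unlock.
(* The real line carries two measurable structures, with the same measurable
   sets but distinct displays: [xi] lands in the default one, [normal_prob] and
   [lebesgue_measure] live on [measurableTypeR R]. *)
have mxi : measurable_fun setT (xi : T -> measurableTypeR R).
  by move=> _ A mA; rewrite setTI; exact: (@measurable_funPTI _ _ _ _ xi A mA).
have mEf : measurable_fun [set: measurableTypeR R] (EFin \o f).
  exact/measurable_EFinP.
transitivity (\int[pushforward Q (xi : T -> measurableTypeR R)]_x (EFin \o f) x)%E.
  rewrite (ge0_integral_pushforward mxi) ?preimage_setT//.
  by move=> y _; rewrite lee_fin.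
transitivity (\int[normal_prob 0 1]_x (EFin \o f) x)%E.
  by apply: eq_measure_integral => A mA _; exact: xiN.
rewrite integral_normal_prob//; apply: eq_integral => x _ /=.
rewrite normal_pdfE ?oner_eq0// -EFinM mulrC; congr EFin.
rewrite /normal_fun subr0 expr1n -mulrA; congr (_ * (_ * _)).
by rewrite mulNr.
Qed.

(** By continuity [k] exceeds [k x0 / 2] on an interval of positive length starting at [x0]. *)
Lemma integral_continuous_gt0 (R : realType) (k : R -> R) (x0 : R) :
  continuous k -> (forall x, 0 <= k x) -> 0 < k x0 ->
  (0 < \int[lebesgue_measure]_x (k x)%:E)%E.
Proof.
move=> ck k0 kx0.
have : \forall x \near x0, k x0 / 2 < k x.
  by apply: (cvgr_gt _ (ck x0)); rewrite ltr_pdivrMr// mulr2n mulrDr mulr1 ltrDl.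
rewrite -nbhs_nearE => /nbhs_ballP[r /= r0 xr].
pose A : set R := [set` `[x0, x0 + r[ ].
have mA : measurable A by exact: measurable_itv.
have mk : measurable_fun setT k by exact: continuous_measurable_fun.
apply: (@lt_le_trans _ _ (\int[lebesgue_measure]_x (k x0 / 2 * \1_A x)%:E)%E).
  under eq_integral do rewrite EFinM.
  rewrite ge0_integralZl//; last 2 first.
  - by apply/measurable_EFinP; exact: measurable_indic.
  - by rewrite lee_fin divr_ge0// ltW.
  rewrite integral_indic// setIT mule_gt0//; first by rewrite lte_fin divr_gt0.
  have := lebesgue_measure_itv `[x0, x0 + r[.
  by rewrite /= lte_fin ltrDl r0 => ->; rewrite -EFinD addrAC subrr add0r lte_fin.
apply: ge0_le_integral => //.
- by move=> x _; rewrite lee_fin mulr_ge0// divr_ge0// ltW.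
- by apply/measurable_EFinP; apply: measurable_funM => //; exact: measurable_indic.
- exact/measurable_EFinP.
- move=> x _; rewrite lee_fin indicE; have [|_] := boolP (x \in A).
    rewrite inE /A /= in_itv/= => /andP[x1 x2]; rewrite mulr1 ltW//.
    apply: xr; rewrite /ball/= distrC ger0_norm ?subr_ge0//; lra.
  by rewrite mulr0.
Qed.

(** * Asymptotics of the annealed partition function *)

Lemma sum_bin_pow2 (R : realType) (N : nat) : \sum_(m < N.+1) 'C(N, m)%:R = 2 ^+ N :> R.
Proof.
rewrite -natrX -[2%N]/(1 + 1)%N expnDn natr_sum; apply: eq_bigr => m _.
by rewrite !exp1n !muln1.
Qed.

(* The constants c_N and A_N of the header. *)
Definition tilt (R : realType) (beta : R) (p : nat -> R) (N : nat) : R :=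
  N%:R * (log_edge R (p N) (beta / (2 * N%:R * p N))
          - log_edge R (p N) (- (beta / (2 * N%:R * p N)))).

Definition log_mean (R : realType) (beta : R) (p : nat -> R) (N : nat) : R :=
  N%:R ^+ 2 * (log_edge R (p N) (beta / (2 * N%:R * p N))
               + log_edge R (p N) (- (beta / (2 * N%:R * p N)))) / 2.

(** The exponent of [prod_spin_pairs] is rewritten in the normalised spin, which needs [0 < N];
    configurations are then grouped by total spin. *)
Lemma expectation_partition_fun_tilt (R : realType) (d : measure_display)
    (T : measurableType d) (P : probability T R) (N : nat) (p : nat -> R) (beta : R)
    (eps : 'I_N -> 'I_N -> {RV P >-> R}) (h : R -> R) :
  (0 < N)%N -> 0 < p N <= 1 ->
  mutually_independent (fun ij : 'I_N * 'I_N => eps ij.1 ij.2) ->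
  (forall i j, P [set w | eps i j w = 1] = (p N)%:E) ->
  (forall i j, P [set w | eps i j w = 0] = (1 - p N)%:E) ->
  (forall x, 0 <= h x) ->
  fine 'E_P[fun w => partition_fun (p N) beta h (fun i j => eps i j w)] =
  expR (log_mean R beta p N) *
  \sum_(m < N.+1) 'C(N, m)%:R *
    (h (spin_node R N m) * expR (tilt R beta p N / 2 * spin_node R N m ^+ 2)).
Proof.
move=> N0 /andP[q0 q1] epsI eps1 eps0 h0.
rewrite (expectation_partition_fun _ _ _ _ _ _ beta _ _ epsI eps1 eps0 h0).
set x := beta / (2 * N%:R * p N).
pose w y : R := 1 - p N + p N * expR (x * y).
have w0 y : 0 < w y by have := expR_gt0 (x * y); rewrite /w; nra.
pose F (S : R) := expR (log_mean R beta p N) *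
  (h (S / Num.sqrt N%:R) * expR (tilt R beta p N / 2 * (S / Num.sqrt N%:R) ^+ 2)).
transitivity (\sum_(s : config N) F (\sum_(i < N) spin R s i)).
  apply: eq_bigr => s _; rewrite (prod_spin_pairs _ _ _ w)//.
  rewrite [X in expR X](_ : _ = log_mean R beta p N
      + tilt R beta p N / 2 * ((\sum_(i < N) spin R s i) / Num.sqrt N%:R) ^+ 2).
    by rewrite expRD /F -(mulrA (expR _)) [in RHS](mulrC (h _)).
  rewrite /log_mean /tilt -/x expr_div_n sqr_sqrtr// /w mulr1 mulrN1.
  rewrite -/(log_edge R (p N) x) -/(log_edge R (p N) (- x)).
  by field; rewrite pnatr_eq0 -lt0n.
rewrite sum_config_spin mulr_sumr; apply: eq_bigr => m _.
by rewrite /F -/(spin_node R N m) mulrCA.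
Qed.

Lemma continuous_sqr_scale (R : realType) (a : R) : continuous (fun x : R => a * x ^+ 2).
Proof.
by move=> x; apply: cvgM; [exact: cvg_cst|exact: exprn_continuous].
Qed.

Lemma bounded_fun_le (R : realType) (h : R -> R) : bounded_fun h ->
  exists B : R, forall x, h x <= B.
Proof.
case=> M [_ /(_ (M + 1))]; rewrite ltrDl ltr01 => /(_ isT) HM.
by exists (M + 1) => x; apply: le_trans (HM x I); exact: ler_norm.
Qed.

(** [sum_bin_cvg] is applied to the tilted function and to the constant 1. In the quotient the
    central weight cancels, the second sum is [2 ^+ N], and its limit [sqrt (2 pi)] supplies the
    normalisation of the Gaussian density. *)
Lemma bin_mean_cvg (R : realType) (beta : R) (c : nat -> R) (h : R -> R) :
  beta < 1 -> c N @[N --> \oo] --> beta ->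
  (forall x, 0 <= h x) -> bounded_fun h -> continuous h ->
  (\sum_(m < N.+1) 'C(N, m)%:R *
     (h (spin_node R N m) * expR (c N / 2 * spin_node R N m ^+ 2))) / 2 ^+ N
   @[N --> \oo] -->
  fine (\int[lebesgue_measure]_x
    (normal_peak 1 * (expR (- (x ^+ 2 / 2)) * (h x * expR (beta / 2 * x ^+ 2))))%:E)%E.
Proof.
move=> beta1 cbeta h0 hb hc.
have [B hB] := bounded_fun_le _ _ hb.
(* Truncating the tilt at [kappa < 1] yields a Gaussian majorant valid for all
   [N]; it changes only finitely many terms. *)
pose kappa := (1 + beta) / 2.
pose c' N := Num.min (c N) kappa.
have c'c : \forall N \near \oo, c' N = c N.
  have : \forall N \near \oo, c N < kappa.
    by apply: (cvgr_lt _ cbeta); rewrite /kappa; lra.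
  by apply: filterS => N cN; rewrite /c' min_l// ltW.
have c'beta : c' N @[N --> \oo] --> beta.
  by apply: cvg_trans cbeta; apply: near_eq_cvg; apply: filterS c'c.
pose F N y := h y * expR (c' N / 2 * y ^+ 2).
pose G y := h y * expR (beta / 2 * y ^+ 2).
have F0 N y : 0 <= F N y by rewrite mulr_ge0 ?expR_ge0.
have F_le N y : F N y * expR (- (y ^+ 2 / 2)) <= B * expR (- ((1 - kappa) / 2 * y ^+ 2)).
  rewrite /F -mulrA -expRD; apply: ler_pM => //.
  rewrite ler_expR.
  have ck : c' N <= kappa by rewrite /c' ge_min lexx orbT.
  have y2 : 0 <= y ^+ 2 by exact: sqr_ge0.
  nra.
have F_cvg (x : R) (y : nat -> R) : y N @[N --> \oo] --> x ->
    F N (y N) @[N --> \oo] --> G x.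
  move=> yx; apply: cvgM; first exact: (cvg_comp _ _ yx (hc x)).
  apply: (@cvg_comp _ _ _ _ expR _ _ _ _ (@continuous_expR R _)).
  apply: cvgM; last exact: (cvg_comp _ _ yx (@exprn_continuous _ 2 _)).
  by apply: cvgM => //; exact: cvg_cst.
have cG : continuous G.
  move=> x; apply: cvgM; first exact: hc.
  apply: (@cvg_comp _ _ _ _ expR _ _ _ _ (@continuous_expR R _)).
  exact: continuous_sqr_scale.
have mG : measurable_fun setT G by exact: continuous_measurable_fun.
have d0 : 0 < (1 - kappa) / 2 by rewrite /kappa; lra.
have [iG cvgG] := sum_bin_cvg R F G B _ d0 F0 F_le F_cvg mG.
pose one (N : nat) (y : R) : R := 1.
have one_le N y : one N y * expR (- (y ^+ 2 / 2)) <= 1 * expR (- (2^-1 * y ^+ 2)).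
  by rewrite /one !mul1r mulrC.
have half0 : (0 : R) < 2^-1 by [].
have [_ cvg1] := sum_bin_cvg R one (fun=> 1) 1 _ half0 (fun _ _ => ler01) one_le
  (fun _ _ _ => @cvg_cst _ _ _ _ _) (@measurable_cst _ _ _ _ _ _).
have peak0 : 0 < normal_peak (1 : R) by apply: normal_peak_gt0; rewrite oner_eq0.
have int1 : fine (\int[lebesgue_measure]_x (expR (- (x ^+ 2 / 2)) * 1)%:E)%E
    = (normal_peak (1 : R))^-1.
  rewrite (_ : (\int[_]_x _)%E = (\int[lebesgue_measure]_x (expR (- (1 / 2 * x ^+ 2)))%:E)%E).
    by rewrite integral_expR_sqr// /normal_peak invrK expr1n mul1r divr1.
  by apply: eq_integral => x _; rewrite mulr1 mul1r mulrC.
rewrite int1 in cvg1.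
have limE : fine (\int[lebesgue_measure]_x
      (normal_peak 1 * (expR (- (x ^+ 2 / 2)) * (h x * expR (beta / 2 * x ^+ 2))))%:E)%E
    = fine (\int[lebesgue_measure]_x (expR (- (x ^+ 2 / 2)) * G x)%:E)%E
      / (normal_peak 1)^-1.
  under eq_integral do rewrite EFinM.
  rewrite integralZl// fineM//; last exact: integrable_fin_num.
  by rewrite invrK mulrC.
rewrite limE.
apply: (@cvg_trans _ ((fun N =>
  (2 / Num.sqrt N%:R / bin_weight R N (uphalf N)
    * \sum_(m < N.+1) 'C(N, m)%:R * F N (spin_node R N m))
  / (2 / Num.sqrt N%:R / bin_weight R N (uphalf N)
    * \sum_(m < N.+1) 'C(N, m)%:R * one N (spin_node R N m))) @ \oo)); last first.
  apply: cvgM; first exact: cvgG.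
  apply: cvgV; last exact: cvg1.
  by rewrite gt_eqF// invr_gt0.
apply: near_eq_cvg; near=> N.
have N0 : (0 < N)%N by near: N; exact: nbhs_infty_gt.
have s0 := sqrtn_gt0 R N N0.
have w0 := bin_weight_center_gt0 R N.
rewrite -mulf_div divff ?mul1r; last first.
  by rewrite gt_eqF// !mulr_gt0 ?invr_gt0.
congr (_ / _).
  by apply: eq_bigr => m _; rewrite /F (near c'c N).
by rewrite -sum_bin_pow2; apply: eq_bigr => m _; rewrite mulr1.
Unshelve. all: by end_near. Qed.

Lemma inv_cvg_pinfty (R : realType) (u : nat -> R) :
  u N @[N --> \oo] --> +oo -> (u N)^-1 @[N --> \oo] --> 0.
Proof.
by move=> uy; apply/gtr0_cvgV0 => //; move/cvgryPgt : uy => /(_ 0).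
Qed.

Lemma cvg0_le (R : realType) (u v : nat -> R) :
  (\forall N \near \oo, `|u N| <= v N) -> v N @[N --> \oo] --> 0 ->
  u N @[N --> \oo] --> 0.
Proof.
move=> uv v0; apply: (@squeeze_cvgr _ _ _ _ (- v) v) => //.
  by apply: filterS uv => N; rewrite ler_norml.
by rewrite -oppr0; exact: cvgN.
Qed.

(** * Expansion of [tilt] and [log_mean] for a small edge field *)

Section field_asymptotics.
Context (R : realType) (beta : R) (p : nat -> R).
Hypothesis beta0 : 0 < beta.
Hypothesis p01 : forall N, 0 < p N <= 1.
Hypothesis pN : p N * N%:R @[N --> \oo] --> +oo.

Let x N : R := beta / (2 * N%:R * p N).

Lemma field_cvg0 : x N @[N --> \oo] --> 0.
Proof.
rewrite /x (_ : (fun N => _) = fun N => beta / 2 * (p N * N%:R)^-1); last first.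
  by apply/funext => N; rewrite -mulrA (mulrC N%:R) invfM mulrA.
rewrite -(mulr0 (beta / 2)); apply: cvgM; first exact: cvg_cst.
exact: inv_cvg_pinfty.
Qed.

Let xE N : (0 < N)%N -> N%:R * p N * x N = beta / 2.
Proof.
move=> N0; have /andP[p0 _] := p01 N; rewrite /x.
by field; rewrite (gt_eqF p0) pnatr_eq0 -lt0n N0.
Qed.

Let x01 : \forall N \near \oo, (0 < N)%N /\ 0 <= x N <= 1.
Proof.
have xle : \forall N \near \oo, x N <= 1 by apply: (cvgr_le _ field_cvg0); exact: ltr01.
near=> N; split; first by near: N; exact: nbhs_infty_gt.
have /andP[p0 _] := p01 N.
apply/andP; split; last by near: N.
by rewrite divr_ge0 ?mulr_ge0 ?(ltW beta0) ?(ltW p0).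
Unshelve. all: by end_near. Qed.

(** Since [2 N p x = beta], [log_edge_diff_bounds] squeezes the tilt between [beta * expR (- x)] and
    [beta * expR x]. *)
Lemma tilt_cvg : tilt R beta p N @[N --> \oo] --> beta.
Proof.
apply: (@squeeze_cvgr _ _ _ _ (fun N => beta * expR (- x N)) (fun N => beta * expR (x N))).
- apply: filterS x01 => N [N0 /andP[x0 _]].
  have /andP[L U] := log_edge_diff_bounds _ _ _ (p01 N) x0.
  have NR : 0 <= N%:R :> R by [].
  have betaE : beta = N%:R * (2 * (p N * x N)).
    by rewrite -[beta](@divfK _ 2)// -(xE N N0); ring.
  by rewrite /tilt -/(x N) betaE -!(mulrA N%:R) !ler_wpM2l.
- rewrite -[X in _ --> X]mulr1; apply: cvgM; first exact: cvg_cst.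
  rewrite -expR0 -oppr0.
  apply: (@cvg_comp _ _ _ _ expR _ _ _ _ (@continuous_expR R _)).
  by apply: cvgN; exact: field_cvg0.
- rewrite -[X in _ --> X]mulr1; apply: cvgM; first exact: cvg_cst.
  rewrite -expR0.
  apply: (@cvg_comp _ _ _ _ expR _ _ _ _ (@continuous_expR R _)).
  exact: field_cvg0.
Qed.

Let sqr_x_cvg0 (a : R) : a * x N ^+ 2 @[N --> \oo] --> 0.
Proof.
have := cvg_comp _ _ field_cvg0 (@exprn_continuous _ 2 _); rewrite expr0n/= => x2.
by rewrite -(mulr0 a); apply: cvgM; [exact: cvg_cst|exact: x2].
Qed.

Let log_mean_bound N : (0 < N)%N -> 0 <= x N <= 1 ->
  `|log_mean R beta p N - N%:R ^+ 2 * p N * (1 - p N) * (cosh (x N) - 1)|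
  <= 5 / 4 * beta ^+ 2 * x N ^+ 2.
Proof.
move=> N0 xN; have := log_edge_sum_bounds _ _ _ (p01 N) xN.
have N20 : 0 <= N%:R ^+ 2 :> R by rewrite exprn_ge0.
move=> /(ler_wpM2l N20).
rewrite -{1}(ger0_norm N20) -normrM => h.
rewrite /log_mean -/(x N).
rewrite (_ : 5 / 4 * beta ^+ 2 * x N ^+ 2 = N%:R ^+ 2 * (5 * p N ^+ 2 * x N ^+ 4)).
  by apply: le_trans h; rewrite le_eqVlt; apply/orP; left; apply/eqP; congr `|_|; field.
rewrite (_ : beta = 2 * (N%:R * p N * x N)); last by rewrite xE//; field.
by field.
Qed.

(** In [N^2 p (1 - p) (cosh x - 1)] the part with [p^2] tends to [(N p x)^2 / 2 = beta^2 / 8]. The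
    two errors are [5/4] and [1/4] of [beta^2 x^2], together below the bound used. *)
Lemma log_mean_cvg_cosh :
  log_mean R beta p N - (- (beta ^+ 2 / 8)
    + N%:R ^+ 2 * p N * (cosh (beta / (2 * N%:R * p N)) - 1)) @[N --> \oo] --> 0.
Proof.
apply: (cvg0_le _ _ (fun N => 2 * beta ^+ 2 * x N ^+ 2)); last exact: sqr_x_cvg0.
apply: filterS x01 => N [N0 xN]; rewrite -/(x N).
have := log_mean_bound N N0 xN.
have /andP[C1 C2] := cosh_bounds _ _ xN.
set C := cosh (x N) - 1 in C1 C2 *.
have E : (N%:R * p N * x N) ^+ 2 = beta ^+ 2 / 4 by rewrite xE//; field.
have NP0 : 0 <= N%:R ^+ 2 * p N ^+ 2 by rewrite mulr_ge0 ?exprn_ge0// ltW//; case/andP: (p01 N).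
have D1 : beta ^+ 2 / 8 <= N%:R ^+ 2 * p N ^+ 2 * C.
  apply: le_trans (ler_wpM2l NP0 C1).
  by rewrite (_ : _ * (_ / 2) = (N%:R * p N * x N) ^+ 2 / 2); [rewrite E; lra|field].
have D2 : N%:R ^+ 2 * p N ^+ 2 * C <= beta ^+ 2 / 8 + beta ^+ 2 / 4 * x N ^+ 2.
  apply: (le_trans (ler_wpM2l NP0 C2)).
  rewrite -E (_ : beta ^+ 2 / 8 = (N%:R * p N * x N) ^+ 2 / 2); last by rewrite E; field.
  by rewrite le_eqVlt; apply/orP; left; apply/eqP; field.
have bx : 0 <= beta ^+ 2 * x N ^+ 2 by rewrite mulr_ge0 ?sqr_ge0.
rewrite !ler_norml => /andP[B1 B2].
apply/andP; split; lra.
Qed.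

(** The quadratic term of [cosh x - 1] gives the stated exponent exactly. The quartic remainder
    [N^2 p x^4] equals [beta^4 / (16 p^3 N^2)], which is where the growth of [p^3 N^2] enters. *)
Lemma log_mean_cvg_gauss : p N ^+ 3 * N%:R ^+ 2 @[N --> \oo] --> +oo ->
  log_mean R beta p N - (1 - p N) * beta ^+ 2 / (8 * p N) @[N --> \oo] --> 0.
Proof.
move=> p3N.
apply: (cvg0_le _ _ (fun N => 5 / 4 * beta ^+ 2 * x N ^+ 2
    + beta ^+ 4 / 16 * (p N ^+ 3 * N%:R ^+ 2)^-1)); last first.
  rewrite -[X in _ --> X]addr0; apply: cvgD; first exact: sqr_x_cvg0.
  rewrite -[X in _ --> X](mulr0 (beta ^+ 4 / 16)).
  by apply: cvgM; [exact: cvg_cst|exact: inv_cvg_pinfty].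
apply: filterS x01 => N [N0 xN].
have := log_mean_bound N N0 xN.
have /andP[C1 C2] := cosh_bounds _ _ xN.
set C := cosh (x N) - 1 in C1 C2 *.
have /andP[p0 p1] := p01 N.
have Nn0 : N%:R != 0 :> R by rewrite pnatr_eq0 -lt0n.
have pn0 : p N != 0 by rewrite gt_eqF.
have E1 : (1 - p N) * beta ^+ 2 / (8 * p N) = N%:R ^+ 2 * p N * (1 - p N) * (x N ^+ 2 / 2).
  by rewrite /x; field; rewrite pn0 Nn0.
have E2 : beta ^+ 4 / 16 * (p N ^+ 3 * N%:R ^+ 2)^-1 = N%:R ^+ 2 * p N * x N ^+ 4.
  by rewrite /x; field; rewrite pn0 Nn0.
rewrite E1 E2.
have K0 : 0 <= N%:R ^+ 2 * p N by rewrite mulr_ge0 ?exprn_ge0// ltW.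
have q0 : 0 <= N%:R ^+ 2 * p N * (1 - p N) by rewrite mulr_ge0// subr_ge0.
have D1 := ler_wpM2l q0 C1.
have D2 := ler_wpM2l q0 C2.
have D3 : N%:R ^+ 2 * p N * (1 - p N) * x N ^+ 4 <= N%:R ^+ 2 * p N * x N ^+ 4.
  have x4 : 0 <= x N ^+ 4 by rewrite exprn_ge0//; case/andP: xN.
  by rewrite ler_wpM2r// ler_piMr//; lra.
move: q0 D1 D2 D3; set q := _ * (1 - p N); set K := _ * p N.
move=> q0 D1 D2 D3; rewrite !ler_norml => /andP[B1 B2].
apply/andP; split; lra.
Qed.

End field_asymptotics.

(** Finiteness has to be shown along with positivity, as [fine] sends an infinite integral to 0. For
    [beta < 1] a multiple of [expR (- ((1 - beta) / 2 * x ^+ 2))] is a majorant. *)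
Lemma normal_mean_gt0 (R : realType) (beta : R) (h : R -> R) : beta < 1 ->
  (forall x, 0 <= h x) -> bounded_fun h -> continuous h -> (exists x, h x != 0) ->
  0 < fine (\int[lebesgue_measure]_x
    (normal_peak 1 * (expR (- (x ^+ 2 / 2)) * (h x * expR (beta / 2 * x ^+ 2))))%:E)%E.
Proof.
move=> beta1 h0 hb hc [x0 hx0].
have peak0 : 0 < normal_peak (1 : R) by apply: normal_peak_gt0; rewrite oner_eq0.
pose k x := normal_peak 1 * (expR (- (x ^+ 2 / 2)) * (h x * expR (beta / 2 * x ^+ 2))).
have ck : continuous k.
  move=> x; apply: cvgM; first exact: cvg_cst.
  apply: cvgM.
    apply: (@cvg_comp _ _ _ _ expR _ _ _ _ (@continuous_expR R _)).
    by apply: cvgN; apply: cvgM; [exact: exprn_continuous|exact: cvg_cst].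
  apply: cvgM; first exact: hc.
  apply: (@cvg_comp _ _ _ _ expR _ _ _ _ (@continuous_expR R _)).
  exact: continuous_sqr_scale.
have k0 x : 0 <= k x by rewrite !mulr_ge0 ?expR_ge0// ltW.
apply: fine_gt0; apply/andP; split.
  apply: (integral_continuous_gt0 _ _ x0 ck k0).
  by rewrite !mulr_gt0 ?expR_gt0// lt_neqAle eq_sym hx0 h0.
have [B hB] := bounded_fun_le _ _ hb.
have a0 : 0 < 1 - beta by lra.
apply: (@le_lt_trans _ _ (\int[lebesgue_measure]_x
    ((normal_peak 1 * B)%:E * (expR (- ((1 - beta) / 2 * x ^+ 2)))%:E))%E).
  apply: ge0_le_integral => //.
  - by move=> x _; rewrite lee_fin; exact: k0.
  - apply/measurable_EFinP; exact: continuous_measurable_fun.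
  - apply: measurable_funeM.
    exact: measurable_int (integrable_expR_sqr _ _ a0).
  - move=> x _; rewrite -EFinM lee_fin /k -(mulrA (normal_peak 1) B) ler_wpM2l ?(ltW peak0)//.
    rewrite mulrCA -expRD ler_pM ?expR_ge0// ler_expR; lra.
rewrite integralZl//; last exact: integrable_expR_sqr.
by rewrite integral_expR_sqr// -EFinM ltry.
Qed.

(** Since [p <= 1], [p^3 N^2] is at most [(p N)^2]. *)
Lemma cvg_pinfty_of_cube (R : realType) (p : nat -> R) : (forall N, 0 < p N <= 1) ->
  p N ^+ 3 * N%:R ^+ 2 @[N --> \oo] --> +oo -> p N * N%:R @[N --> \oo] --> +oo.
Proof.
move=> p01 /cvgryPge p3; apply/cvgryPge => A.
have := p3 (A ^+ 2); apply: filterS => N AN.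
have /andP[p0 p1] := p01 N.
have pN0 : 0 <= p N * N%:R by rewrite mulr_ge0// ltW.
apply: (le_trans (ler_norm A)).
rewrite -[leRHS]ger0_norm// -ler_sqr ?nnegrE// !real_normK ?num_real//.
apply: (le_trans AN); rewrite exprMn ler_wpM2r ?exprn_ge0//.
by rewrite exprS ler_piMl// exprn_ge0// ltW.
Qed.

(** The quotient is [expR (A - B)] times [S / C / E], so the exponents must agree up to a vanishing
    difference; a vanishing relative error would not suffice. *)
Lemma cvg_diff_ratio (R : realType) (A B C : nat -> R) (S : nat -> R) (E : R) :
  E != 0 -> A N - B N @[N --> \oo] --> 0 -> S N / C N @[N --> \oo] --> E ->
  asymp_equiv (fun N => expR (A N) * S N) (fun N => expR (B N) * C N * E).
Proof.
move=> E0 AB SC; rewrite /asymp_equiv.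
rewrite (_ : (fun N => _) = (fun N => expR (A N - B N) * (S N / C N / E))).
  rewrite -[X in _ --> X]mul1r; apply: cvgM.
    by rewrite -expR0; exact: (cvg_comp _ _ AB (@continuous_expR R _)).
  by rewrite -(divff E0); apply: cvgM => //; exact: cvg_cst.
by apply/funext => N; rewrite expRB !invfM; ring.
Qed.

Lemma normal_mean_cst1 (R : realType) (beta : R) : beta < 1 ->
  fine (\int[lebesgue_measure]_x
    (normal_peak 1 * (expR (- (x ^+ 2 / 2)) * (1 * expR (beta / 2 * x ^+ 2))))%:E)%E
  = (Num.sqrt (1 - beta))^-1.
Proof.
move=> beta1; have a0 : 0 < 1 - beta by lra.
transitivity (fine ((normal_peak 1)%:E * \int[lebesgue_measure]_x
    (expR (- ((1 - beta) / 2 * x ^+ 2)))%:E)%E).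
  rewrite -integralZl//; last exact: integrable_expR_sqr.
  congr fine; apply: eq_integral => x _; rewrite -EFinM mul1r -expRD.
  by congr (_ * expR _)%:E; field.
rewrite integral_expR_sqr//= /normal_peak expr1n mul1r.
have pi2 : 0 < pi *+ 2 :> R by rewrite mulrn_wgt0// pi_gt0.
by rewrite sqrtrM ?(ltW pi2)// sqrtrV ?(ltW a0)// mulKf// gt_eqF// sqrtr_gt0.
Qed.

Theorem theorem1p4 (R : realType)
  (beta : R) (beta01 : 0 < beta < 1)
  (p : nat -> R) (p01 : forall N : nat, 0 < p N <= 1)
  (d : nat -> measure_display)
  (Omega : forall N : nat, measurableType (d N))
  (P : forall N : nat, probability (Omega N) R)
  (eps : forall N : nat, 'I_N -> 'I_N -> {RV (P N) >-> R})
  (eps_indep : forall N : nat,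
     mutually_independent (fun ij : 'I_N * 'I_N => eps N ij.1 ij.2))
  (eps1 : forall (N : nat) (i j : 'I_N),
     P N [set w | eps N i j w = 1] = (p N)%:E)
  (eps0 : forall (N : nat) (i j : 'I_N),
     P N [set w | eps N i j w = 0] = (1 - p N)%:E)
  (g : R -> R) (g_ge0 : forall x : R, 0 <= g x) (g_bounded : bounded_fun g)
  (g_cont : continuous g) (g_neq0 : exists x : R, g x != 0)
  (d' : measure_display) (Omega' : measurableType d')
  (Q : probability Omega' R) (xi : {RV Q >-> R})
  (xi_normal : forall A : set R, measurable A ->
     distribution Q xi A = normal_prob 0 1 A) :
  let EZ (h : R -> R) (N : nat) : R :=
    fine 'E_(P N)[fun w => partition_fun (p N) beta h
                             (fun i j => eps N i j w)] in
  let Exi : R :=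
    fine 'E_Q[fun w => g (xi w) * expR (beta / 2 * xi w ^+ 2)] in
  [/\
      p N * N%:R @[N --> \oo] --> +oo ->
      asymp_equiv (EZ g) (fun N : nat =>
        expR (- (beta ^+ 2 / 8)
              + N%:R ^+ 2 * p N * (cosh (beta / (2 * N%:R * p N)) - 1))
        * 2 ^+ N * Exi),
      p N ^+ 3 * N%:R ^+ 2 @[N --> \oo] --> +oo ->
      asymp_equiv (EZ g) (fun N : nat =>
        expR ((1 - p N) * beta ^+ 2 / (8 * p N)) * 2 ^+ N * Exi)
    &
      p N ^+ 3 * N%:R ^+ 2 @[N --> \oo] --> +oo ->
      asymp_equiv (EZ (fun=> 1)) (fun N : nat =>
        expR ((1 - p N) * beta ^+ 2 / (8 * p N))
        * (2 ^+ N / Num.sqrt (1 - beta)))].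
Proof.
move=> EZ Exi; have /andP[beta0 beta1] := beta01.
pose S h N := \sum_(m < N.+1) 'C(N, m)%:R *
  (h (spin_node R N m) * expR (tilt R beta p N / 2 * spin_node R N m ^+ 2)).
pose mean h := fine (\int[lebesgue_measure]_x
  (normal_peak 1 * (expR (- (x ^+ 2 / 2)) * (h x * expR (beta / 2 * x ^+ 2))))%:E)%E.
(* All three claims are instances: only the test function [h] and the approximation [B] of
   [log_mean] vary. *)
have key (h : R -> R) (B : nat -> R) : (forall x, 0 <= h x) -> bounded_fun h ->
    continuous h -> (exists x, h x != 0) ->
    p N * N%:R @[N --> \oo] --> +oo -> log_mean R beta p N - B N @[N --> \oo] --> 0 ->
    asymp_equiv (EZ h) (fun N => expR (B N) * 2 ^+ N * mean h).
  move=> h0 hb hc hn0 pN AB.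
  have mean0 : mean h != 0 by rewrite gt_eqF//; exact: normal_mean_gt0.
  have SC := bin_mean_cvg _ _ _ _ beta1 (tilt_cvg _ _ _ beta0 p01 pN) h0 hb hc.
  apply: cvg_trans (cvg_diff_ratio _ _ _ _ _ _ mean0 AB SC).
  apply: near_eq_cvg; near=> N; congr (_ / _).
  have N0 : (0 < N)%N by near: N; exact: nbhs_infty_gt.
  by rewrite /EZ (expectation_partition_fun_tilt _ _ _ _ _ _ _ _ _ N0 (p01 N)).
have ExiE : Exi = mean g.
  rewrite /Exi (expectation_normal _ _ _ _ _ (fun x => g x * expR (beta / 2 * x ^+ 2)))//.
    by move=> x; rewrite mulr_ge0 ?expR_ge0.
  apply: measurable_funM; first exact: continuous_measurable_fun.
  apply: measurableT_comp; first exact: measurable_expR.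
  exact: continuous_measurable_fun (continuous_sqr_scale _ _).
split.
- move=> pN; rewrite ExiE; apply: key => //.
  exact: log_mean_cvg_cosh.
- move=> p3N; have pN := cvg_pinfty_of_cube _ _ p01 p3N.
  by rewrite ExiE; apply: key => //; exact: log_mean_cvg_gauss.
- move=> p3N; have pN := cvg_pinfty_of_cube _ _ p01 p3N.
  rewrite [X in asymp_equiv _ X](_ : _ =
      fun N => expR ((1 - p N) * beta ^+ 2 / (8 * p N)) * 2 ^+ N * mean (fun=> 1)); last first.
    by apply/funext => N; rewrite /mean normal_mean_cst1// mulrA.
  apply: key => //.
  + exact: bounded_cst.
  + by move=> x; exact: cvg_cst.
  + exact: log_mean_cvg_gauss.
Unshelve. all: by end_near. Qed.
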